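(* Let $V$ be a vertex superalgebra with a Hamiltonian operator $H$ with real eigenvalues and $g$ a diagonalizable automorphism of $V$ commuting with $H$ with eigenvalues of modulus $1$. Suppose that $V$ is freely generated by free generators $\{e_\alpha\}_{\alpha\in I}$ homogeneous for $g$, $H$ and the parity, with an ordered index set $I$, and is pregraded by $\Gamma_{\ge0}$. Let $U$ be the quotient vertex superalgebra of $V$ by a $(g,H)$-invariant ideal. Then, inside $X_V$, $$X_{g,H}(U)\subset X_U\cap X_{g,H}(V).$$ Therefore $\dim X_{g,H}(U)=0$ if $X_U$ is lisse along $(X_V)_{\ne\bar0}$.
   Context: **Vertex superalgebras.** Over $\mathbb C$; vacuum $|0\rangle$, translation operator $\partial$, $a(z)=\sum_{n\in\mathbb Z}a_{(n)}z^{-n-1}$, $[a_\lambda b]=\sum_{n\ge0}\frac{\lambda^n}{n!}a_{(n)}b$, $:\!ab\!:\,=a_{(-1)}b$ (nested from the right), $\partial^{(k)}=\partial^k/k!$. A Hamiltonian operator is a semisimple operator with $[H,a(z)]=z\partial_za(z)+(Ha)(z)$; $\Delta_a$ is the $H$-eigenvalue; $\theta_H=e^{2\pi iH}$. **Poisson algebras and varieties.** Let $T$ be $V$ or $U$ (with induced $g,H$). For $a$ with $g(a)=e^{2\pi i\gamma}a$, $Ha=\Delta_aa$ let $\epsilon_a$ be the unique real number with $-1<\epsilon_a\le0$, $\epsilon_a+\Delta_a\in\gamma+\mathbb Z$; $\chi_{a,b}=1$ if $\epsilon_a+\epsilon_b\le-1$, else $0$. $T_{g,H}=\operatorname{Span}\{a:\epsilon_a=0\}=T^{g\circ\theta_H^{-1}}$,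 $C_{g,H}(T)=\operatorname{Span}\{a_{(-2+\chi_{a,b})}b:a,b\in T\text{ homogeneous}\}\cap T_{g,H}$, and $R_{g,H}(T)=T_{g,H}/C_{g,H}(T)$ is a Poisson superalgebra with $\bar a\cdot\bar b=\overline{a_{(-1)}b}$, $\{\bar a,\bar b\}=\overline{a_{(0)}b}$. $X_{g,H}(T)=\operatorname{Specm}R_{g,H}(T)$ (maximal spectrum). Taking $g=\theta_H$: $R_{\theta_H,H}(T)=T/C_2(T)$ with $C_2(T)=\operatorname{Span}\{a_{(-2)}b\}$, and $X_T=\operatorname{Specm}(T/C_2(T))$ is the associated variety. The projection of $T$ onto $T_{g,H}$ killing the other $g\circ\theta_H^{-1}$-eigenspaces induces a surjection $R_{\theta_H,H}(T)\to R_{g,H}(T)$, and $V\to U$ induces surjections $R_{g,H}(V)\to R_{g,H}(U)$, $R_{\theta_H,H}(V)\to R_{\theta_H,H}(U)$; through these, $X_U$, $X_{g,H}(V)$, $X_{g,H}(U)$ are regarded as closed subvarieties of $X_V$. Under the assumptions on $V$, $X_{g,H}(V)$ is identified with the fixed locus $(X_V)_{\bar0}$ of $g\circ\theta_H^{-1}$ on $X_V$, and $(X_V)_{\ne\bar0}$ denotes its complement, so that $X_V=X_{g,H}(V)\sqcup(X_V)_{\ne\bar0}$. $X_U$ is lisse along a subset $Y\subset X_V$ if $\dim(X_U\cap Y^\perp)=0$, where $Y^\perp=\{y\in X_V:y\notin Y\}$. ''Dimension $0$'' is understood to allow the empty set. **Free generation and pregrading.** $\Gamma\subset\mathbb R$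 is a discrete additive subgroup, $\Gamma_{\ge0}=\Gamma\cap\mathbb R_{\ge0}$, $\Gamma_{>0}=\Gamma\cap\mathbb R_{>0}$; $\zeta_-$ is the largest element of $\Gamma_{\ge0}$ strictly smaller than $\zeta\in\Gamma_{>0}$. $\mathbb I=\mathbb Z_{\ge0}\times I$ ($I$ totally ordered) is ordered by $(k,\alpha)<(l,\beta)$ iff $\alpha<\beta$, or $\alpha=\beta$ and $k<l$; $e_{(k,\alpha)}=\partial^{(k)}e_\alpha$. $V$ is freely generated by $\{e_\alpha\}$ if the $:\!e_{i_1}\cdots e_{i_s}\!:$ ($s\ge0$, $i_j\le i_{j+1}$, $i_j<i_{j+1}$ if $e_{i_j}$ odd) form a basis of $V$. $V$ is pregraded by $\Gamma_{\ge0}$ if there is a grading $\alpha\mapsto\zeta_\alpha\in\Gamma_{>0}$ with $[\mathfrak v_{\zeta_1\,\lambda}\mathfrak v_{\zeta_2}]\subset\mathbb C[\lambda]\otimes V_{(\zeta_1+\zeta_2)_-}$ for all $\zeta_1,\zeta_2$, where $\mathfrak v_\zeta=\operatorname{Span}\{e_\alpha:\zeta_\alpha=\zeta\}$ and $V_\zeta=\sum_{\zeta_1+\cdots+\zeta_s\le\zeta}:\!(\partial^{k_1}\mathfrak v_{\zeta_1})\cdots(\partial^{k_s}\mathfrak v_{\zeta_s})\!:$ ($s=0$ gives $\mathbb C|0\rangle$). *)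

(* Defs.v *)
(* The ground field is R[i] for an arbitrary R : realType. *)
From HB Require Import structures.
From mathcomp Require Import all_boot all_order all_algebra.
From mathcomp Require Import all_classical all_reals all_analysis.
From mathcomp Require Import complex.

Set Implicit Arguments.
Unset Strict Implicit.
Unset Printing Implicit Defensive.

Import Order.TTheory GRing.Theory Num.Theory.

Local Open Scope classical_set_scope.
Local Open Scope ring_scope.
Local Open Scope complex_scope.

Definition lsubspace (K : fieldType) (V : lmodType K) (A : set V) : Prop :=
  A 0 /\ forall (k : K) (x y : V), A x -> A y -> A (k *: x + y).

Definition lspan (K : fieldType) (V : lmodType K) (A : set V) : set V :=
  smallest (@lsubspace K V) A.

Definition eigenval (K : fieldType) (V : lmodType K) (f : V -> V) (l : K) :=
  exists2 v : V, v != 0 & f v = l *: v.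

Definition diagonalizable_op (K : fieldType) (V : lmodType K) (f : V -> V) :=
  lspan [set v : V | exists l : K, f v = l *: v] = setT.

(* e^{2 pi i t} *)
Definition e2pi (R : realType) (t : R) : R[i] :=
  cos (2 * pi * t) +i* sin (2 * pi * t).

(* [vs_prod n a b] is a_(n) b, [vs_par false] and [vs_par true] are the even
   and the odd part.  [vs_local] is (z - w)^N [a(z), b(w)] = 0 (super
   commutator), read off at z^(-m-1) w^(-n-1). *)
Record vertexSuperalgebra (R : realType) := VertexSuperalgebra {
  vs_sort :> lmodType R[i];
  vs_par : bool -> set vs_sort;
  vs_vac : vs_sort;
  vs_der : {linear vs_sort -> vs_sort};
  vs_prod : int -> vs_sort -> vs_sort -> vs_sort;
  vs_par_lsubspace : forall p, lsubspace (vs_par p);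
  vs_par_sum : forall a, exists a0 a1,
    [/\ vs_par false a0, vs_par true a1 & a = a0 + a1];
  vs_par_direct : forall a, vs_par false a -> vs_par true a -> a = 0;
  vs_prod_linearl : forall n b, linear (fun a => vs_prod n a b);
  vs_prod_linearr : forall n a, linear (vs_prod n a);
  vs_prod_par : forall n p q a b, vs_par p a -> vs_par q b ->
    vs_par (p (+) q) (vs_prod n a b);
  vs_der_par : forall p a, vs_par p a -> vs_par p (vs_der a);
  vs_field : forall a b, exists N : nat,
    forall n : int, N%:Z <= n -> vs_prod n a b = 0;
  vs_vac_par : vs_par false vs_vac;
  vs_vacl : forall n a, vs_prod n vs_vac a = if n == -1 then a else 0;
  vs_vacr : forall a, vs_prod (-1) a vs_vac = a;
  vs_vacr_ge0 : forall (n : nat) a, vs_prod n%:Z a vs_vac = 0;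
  vs_der_vac : vs_der vs_vac = 0;
  vs_translation : forall n a b,
    vs_der (vs_prod n a b) - vs_prod n a (vs_der b)
      = - (n%:~R *: vs_prod (n - 1) a b);
  vs_local : forall p q a b, vs_par p a -> vs_par q b -> exists N : nat,
    forall (m n : int) (c : vs_sort),
      \sum_(j < N.+1) (((-1) ^+ j * 'C(N, j)%:R : R[i]) *:
        (vs_prod (m + (N - j)%N%:Z) a (vs_prod (n + j%:Z) b c)
         - ((-1) ^+ (p && q) : R[i]) *:
             vs_prod (n + j%:Z) b (vs_prod (m + (N - j)%N%:Z) a c))) = 0
}.

Arguments vs_par {R v}.
Arguments vs_vac {R} v.
Arguments vs_der {R v}.
Arguments vs_prod {R v}.

Definition vs_morphism (R : realType) (V W : vertexSuperalgebra R)
    (f : {linear V -> W}) : Prop :=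
  [/\ f (vs_vac V) = vs_vac W,
      forall a, f (vs_der a) = vs_der (f a),
      forall n a b, f (vs_prod n a b) = vs_prod n (f a) (f b) &
      forall p a, vs_par p a -> vs_par p (f a)].

Definition vs_automorphism (R : realType) (V : vertexSuperalgebra R)
    (g : {linear V -> V}) : Prop :=
  vs_morphism g /\ bijective g.

Definition vs_ideal (R : realType) (V : vertexSuperalgebra R) (J : set V) :=
  [/\ lsubspace J,
      forall a, J a -> J (vs_der a),
      forall n a b, J b -> J (vs_prod n a b) /\ J (vs_prod n b a) &
      forall a, J a -> exists a0 a1,
        [/\ J a0 /\ vs_par false a0, J a1 /\ vs_par true a1 & a = a0 + a1]].

(* (U, q) is the quotient of V by the ideal J, up to unique isomorphism. *)
Definition vs_quotient (R : realType) (V U : vertexSuperalgebra R)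
    (J : set V) (q : {linear V -> U}) : Prop :=
  [/\ vs_morphism q, (forall u, exists v, q v = u)
    & J = [set v | q v = 0]].

(* The last condition is [H, a(z)] = z d/dz a(z) + (Ha)(z). *)
Definition hamiltonian (R : realType) (V : vertexSuperalgebra R)
    (H : {linear V -> V}) : Prop :=
  diagonalizable_op H /\
  forall (n : int) (a b : V),
    H (vs_prod n a b) - vs_prod n a (H b)
      = vs_prod n (H a) b - (n + 1)%:~R *: vs_prod n a b.

(* :a_1 ... a_s:, nested from the right *)
Definition normal_prod (R : realType) (V : vertexSuperalgebra R) (s : seq V) :
    V :=
  foldr (vs_prod (-1)) (vs_vac V) s.

Section FreeGeneration.
Context (R : realType) (V : vertexSuperalgebra R).
Context (d : Order.disp_t) (I : orderType d) (e : I -> V).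

Definition dgen (i : nat * I) : V := (i.1`!%:R)^-1 *: iter i.1 vs_der (e i.2).

Definition idx_lt (i j : nat * I) : bool :=
  (i.2 < j.2)%O || (i.2 == j.2) && (i.1 < j.1)%N.

Definition pbw_step (i j : nat * I) : bool :=
  ((i == j) || idx_lt i j) && (`[< vs_par true (dgen i) >] ==> idx_lt i j).

Definition monomial (s : seq (nat * I)) : V := normal_prod (map dgen s).

Definition freely_generated : Prop :=
  (forall (L : seq (seq (nat * I))) (c : seq (nat * I) -> R[i]),
     uniq L -> all (sorted pbw_step) L ->
     \sum_(s <- L) c s *: monomial s = 0 -> forall s, s \in L -> c s = 0) /\
  lspan [set v | exists2 s, sorted pbw_step s & v = monomial s] = setT.

Definition homogeneous_generators (g H : {linear V -> V}) : Prop :=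
  forall al : I, [/\ exists l : R[i], g (e al) = l *: e al,
    exists l : R[i], H (e al) = l *: e al & exists p, vs_par p (e al)].

Definition additive_subgroup (Gamma : set R) : Prop :=
  Gamma 0 /\ forall x y, Gamma x -> Gamma y -> Gamma (x - y).

Definition discrete_subset (Gamma : set R) : Prop :=
  forall x, Gamma x -> exists2 r : R, 0 < r &
    forall y, Gamma y -> `|y - x| < r -> y = x.

(* the largest element of Gamma_{>= 0} strictly smaller than z *)
Definition pred_in (Gamma : set R) (z : R) : R :=
  xget 0 [set x | [/\ Gamma x, 0 <= x < z &
    forall y, Gamma y -> 0 <= y < z -> y <= x]].

Section Pregrading.
Context (Gamma : set R) (zeta : I -> R).

Definition gen_piece (z : R) : set V :=
  lspan [set v | exists2 al, zeta al = z & v = e al].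

(* An element (k, z, v) of s stands for the factor d^k v with v in the
   z-piece of the span of the generators. *)
Definition gen_filtration (z : R) : set V :=
  lspan [set v | exists s : seq (nat * R * V),
    [/\ forall t, t \in s ->
          [/\ Gamma t.1.2, 0 < t.1.2 & gen_piece t.1.2 t.2],
        \sum_(t <- s) t.1.2 <= z &
        v = normal_prod [seq iter t.1.1 vs_der t.2 | t <- s]]].

(* The coefficients of [a_lambda b] are a_(n) b / n!, n >= 0. *)
Definition is_pregrading : Prop :=
  (forall al, Gamma (zeta al) /\ 0 < zeta al) /\
  forall z1 z2 : R, Gamma z1 -> 0 < z1 -> Gamma z2 -> 0 < z2 ->
  forall a b : V, gen_piece z1 a -> gen_piece z2 b ->
  forall n : nat, gen_filtration (pred_in Gamma (z1 + z2)) (vs_prod n%:Z a b).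

End Pregrading.

Definition pregraded (Gamma : set R) : Prop :=
  exists zeta : I -> R, is_pregrading Gamma zeta.

End FreeGeneration.

Section TwistedAlgebra.
Context (R : realType) (T : vertexSuperalgebra R) (g H : {linear T -> T}).

(* a is homogeneous and x = epsilon_a (every x in ]-1, 0] qualifies if a = 0) *)
Definition has_eps (a : T) (x : R) : Prop :=
  exists gamma Delta : R,
    [/\ g a = e2pi gamma *: a, H a = Delta%:C *: a, -1 < x <= 0 &
        exists n : int, x + Delta = gamma + n%:~R].

Definition tw_sub : set T := lspan [set a | has_eps a 0].

Definition tw_other : set T :=
  lspan [set a | exists2 x, x != 0 & has_eps a x].

Definition chi (x y : R) : int := if x + y <= -1 then 1 else 0.

Definition tw_C : set T :=
  lspan [set c | exists a b x y, [/\ has_eps a x, has_eps b y &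
                  c = vs_prod (-2 + chi x y) a b]] `&` tw_sub.

(* projection onto [tw_sub] along [tw_other] *)
Definition tw_proj (a : T) : T :=
  xget 0 [set a0 | tw_sub a0 /\ tw_other (a - a0)].

(* e^{2 pi i t H}, for H diagonalizable with real eigenvalues *)
Definition expH (t : R) (a : T) : T :=
  xget 0 [set b | exists s : seq (R * T),
    [/\ forall u, u \in s -> H u.2 = (u.1)%:C *: u.2,
        a = \sum_(u <- s) u.2 &
        b = \sum_(u <- s) e2pi (t * u.1) *: u.2]].

(* g o theta_H^{-1} *)
Definition twist_op (a : T) : T := g (expH (-1) a).

End TwistedAlgebra.

Definition C2 (R : realType) (T : vertexSuperalgebra R) : set T :=
  lspan [set c | exists a b, c = vs_prod (-2) a b].
Arguments C2 {R} T.

(* For subspaces C <= S of T, the quotient S / C is represented by the set of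
   the cosets a + C, a in S; its product is induced by a_(-1) b. *)
Section Specm.
Context (R : realType) (T : vertexSuperalgebra R) (S C : set T).

Definition cls (a : T) : set T := [set b | C (b - a)].

Definition coset_quot : set (set T) := cls @` S.

(* Two-sided ideals; no parity condition is imposed, as the maximal ones
   contain all odd elements when S / C is a supercommutative algebra. *)
Definition quot_ideal (J : set (set T)) : Prop :=
  [/\ J `<=` coset_quot, J (cls 0),
      forall (k : R[i]) a b, S a -> S b -> J (cls a) -> J (cls b) ->
        J (cls (k *: a + b)) &
      forall a b, S a -> S b -> J (cls b) ->
        J (cls (vs_prod (-1) a b)) /\ J (cls (vs_prod (-1) b a))].

Definition Specm : set (set (set T)) :=
  [set m | [/\ quot_ideal m, m <> coset_quot &
     forall J, quot_ideal J -> m `<=` J -> J = m \/ J = coset_quot]].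

End Specm.

(* preimage of m under the map S / C -> S' / C' induced by f : T -> T' *)
Definition comap (R : realType) (T T' : vertexSuperalgebra R) (f : T -> T')
    (S C : set T) (C' : set T') (m : set (set T')) : set (set T) :=
  [set X | exists a, [/\ S a, X = cls C a & m (cls C' (f a))]].

(* X_T, as a set of ideals of T / C_2(T) *)
Definition assoc_var (R : realType) (T : vertexSuperalgebra R) :=
  Specm [set: T] (C2 T).
Arguments assoc_var {R} T.

(* X_{g,H}(T), as a set of ideals of R_{g,H}(T) *)
Definition tw_var (R : realType) (T : vertexSuperalgebra R)
    (g H : {linear T -> T}) :=
  Specm (tw_sub g H) (tw_C g H).

(* X_{g,H}(T) as a subset of X_T *)
Definition tw_var_in (R : realType) (T : vertexSuperalgebra R)
    (g H : {linear T -> T}) : set (set (set T)) :=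
  comap (tw_proj g H) [set: T] (C2 T) (tw_C g H) @` tw_var g H.

(* Subsets of X_U, regarded as subsets of X_V through V -> U *)
Definition pull_var (R : realType) (V U : vertexSuperalgebra R)
    (q : {linear V -> U}) (Y : set (set (set U))) : set (set (set V)) :=
  comap q [set: V] (C2 V) (C2 U) @` Y.

(* (X_V)_0: the points m fixed by s = g o theta_H^{-1} together with their
   residue field, that is, s a - a in m for every a.  When the residue field is
   the field of complex numbers (e.g. V countably generated) this just says
   that s maps m to itself; in general it is the condition for which the fixed
   locus is X_{g,H}(V). *)
Definition fixed_locus (R : realType) (V : vertexSuperalgebra R)
    (g H : {linear V -> V}) : set (set (set V)) :=
  [set m | assoc_var V m /\ forall a, m (cls (C2 V) (twist_op g H a - a))].

(* (X_V)_{<> 0} *)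
Definition moved_locus (R : realType) (V : vertexSuperalgebra R)
    (g H : {linear V -> V}) : set (set (set V)) :=
  assoc_var V `\` fixed_locus g H.

Section Dimension.
Context (W : Type).
Implicit Types A Z : set (set W).

(* closed subsets of A for the topology induced by the Zariski topology *)
Definition zclosed A Z : Prop :=
  exists F : set W, Z = [set m | A m /\ F `<=` m].

Definition zirreducible A Z : Prop :=
  [/\ zclosed A Z, Z !=set0 &
      forall Z1 Z2, zclosed A Z1 -> zclosed A Z2 -> Z = Z1 `|` Z2 ->
        Z = Z1 \/ Z = Z2].

(* no chain Z_0 < ... < Z_{n+1} of irreducible closed subsets of A *)
Definition dim_le (n : nat) A : Prop :=
  ~ exists Z : nat -> set (set W),
      (forall i, (i <= n.+1)%N -> zirreducible A (Z i)) /\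
      (forall i, (i <= n)%N -> Z i `<` Z i.+1).

(* dimension 0, the empty set being allowed *)
Definition dim0 A : Prop := dim_le 0 A.

End Dimension.

(* XU <= XV is lisse along Y <= XV *)
Definition lisse_along (W : Type) (XV XU Y : set (set W)) : Prop :=
  dim0 (XU `&` (XV `\` Y)).

(* Main.v *)
Require Import Defs.
From HB Require Import structures.
From mathcomp Require Import all_boot all_order all_algebra.
From mathcomp Require Import all_classical all_reals all_analysis.
From mathcomp Require Import complex.
From mathcomp Require Import ring lra.

Set Implicit Arguments.
Unset Strict Implicit.
Unset Printing Implicit Defensive.

Import Order.TTheory GRing.Theory Num.Theory.

Local Open Scope classical_set_scope.
Local Open Scope ring_scope.
Local Open Scope complex_scope.

(** The inclusion is commutative algebra with maximal ideals. The inverse image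
    of a maximal ideal along a surjective algebra morphism is maximal
    ([comap_Specm]), and the square formed by the four surjections
[[
        V / C_2(V)   -->  R_{g,H}(V)
            |                 |
        U / C_2(U)   -->  R_{g,H}(U)
]]
    commutes. So a point of [X_{g,H}(U)], pulled back to [X_V] through
    [U / C_2(U)], is a point of [X_U], and pulled back through [R_{g,H}(V)] it
    is the same point and belongs to [X_{g,H}(V)] ([pull_tw_var_sub]).

    The work lies in the horizontal arrows. Joint eigenvectors of [g] and [H]
    span, and [epsilon_a] depends only on the pair of eigenvalues of [a]; as
    vectors of distinct joint weights are independent ([weight_sum_mem]), the
    space splits into [T_{g,H}] and the span of the homogeneous [a] with
    [epsilon_a <> 0], and the projection onto [T_{g,H}] is well defined and
    linear. It is multiplicative modulo [C_{g,H}] ([tw_proj_mul]) because two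
    homogeneous elements outside [T_{g,H}] have a product in [T_{g,H}] only when
    [epsilon_a + epsilon_b = -1], and then [a_(-1) b] is one of the generators
    of [C_{g,H}]. It maps [C_2] into [C_{g,H}] ([tw_proj_C2]), the delicate
    case being again [epsilon_a + epsilon_b = -1], where
    [a_(-2) b = d (a_(-1) b) - a_(-1) (d b)].

    For the dimension, [g o theta_H^{-1}] is the identity modulo the kernel of
    the projection ([twist_op_sub]), so the points of [X_{g,H}(V)] are fixed by
    it: they avoid the moved locus. Hence [X_{g,H}(U)] is contained in
    [X_U] intersected with the complement of the moved locus, whose dimension
    is [0] by lissity, and the dimension of a subset is at most that of the set
    ([dim_le_subset]). *)

(** * Spans and eigenvectors *)

Section LinearAlgebra.
Context (K : fieldType) (V : lmodType K).
Implicit Types (A B W : set V) (v x y : V).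

Lemma lspan_lsubspace A : lsubspace (lspan A).
Proof.
split=> [W [[W0 _] _] //|k x y Ax Ay W [Wsub AW]].
by apply: Wsub.2; [exact: Ax | exact: Ay].
Qed.

Lemma mem_lspan A v : A v -> lspan A v.
Proof. exact: sub_gen_smallest. Qed.

Lemma lspan_sub A B : lsubspace B -> A `<=` B -> lspan A `<=` B.
Proof. exact: smallest_sub. Qed.

Lemma lsubspaceD W x y : lsubspace W -> W x -> W y -> W (x + y).
Proof. by move=> [_ Wl] Wx Wy; rewrite -[x]scale1r; apply: Wl. Qed.

Lemma lsubspaceZ W k x : lsubspace W -> W x -> W (k *: x).
Proof. by move=> [W0 Wl] Wx; rewrite -[_ *: _]addr0; apply: Wl. Qed.

Lemma lsubspaceB W x y : lsubspace W -> W x -> W y -> W (x - y).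
Proof. by move=> [_ Wl] Wx Wy; rewrite addrC -scaleN1r; apply: Wl. Qed.

Lemma lsubspace_sum W (I : eqType) (s : seq I) (F : I -> V) :
  lsubspace W -> (forall i, i \in s -> W (F i)) -> W (\sum_(i <- s) F i).
Proof.
move=> Wsub WF; rewrite big_seq; apply: big_rec => [|i x s_i Wx].
  exact: Wsub.1.
by apply: lsubspaceD => //; apply: WF.
Qed.

Lemma lsubspace_preim (V' : lmodType K) (f : V -> V') (W : set V') :
  linear f -> lsubspace W -> lsubspace (f @^-1` W).
Proof.
move=> f_lin Wsub; split=> [|k x y Wx Wy] /=; last by rewrite f_lin; apply: Wsub.2.
have := f_lin (-1) 0 0; rewrite scaler0 addr0 scaleN1r addNr => ->.
exact: Wsub.1.
Qed.

Context (I : Type) (f : I -> {linear V -> V}).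

Definition weight_vec (chi : I -> K) : set V :=
  [set v | forall i, f i v = chi i *: v].

Definition weight_span (P : set (I -> K)) : set V :=
  lspan [set v | exists2 chi, P chi & weight_vec chi v].

Definition stable (W : set V) : Prop := forall i v, W v -> W (f i v).

(** Collecting the terms of equal weight is what makes the induction of
    [weight_sum_mem] possible; [F] is cut off outside [s] so that two such sums
    can be added over the union of their supports. *)
Lemma weight_span_sum P v : weight_span P v ->
  exists (s : seq (I -> K)) (F : (I -> K) -> V),
    [/\ uniq s, forall chi, chi \in s -> P chi,
        forall chi, weight_vec chi (F chi), forall chi, chi \notin s -> F chi = 0
      & v = \sum_(chi <- s) F chi].
Proof.
move: v; apply: lspan_sub => [|v [chi Pchi v_chi]]; last first.
  exists [:: chi], (fun psi => if psi == chi then v else 0); split=> //.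
  - by move=> psi; rewrite inE => /eqP ->.
  - move=> psi; case: eqP => [->//|_] i.
    by rewrite linear0 scaler0.
  - by move=> psi; rewrite inE => /negPf ->.
  - by rewrite big_seq1 eqxx.
split=> [|k x y].
  exists [::], (fun=> 0); split=> //; last by rewrite big_nil.
  by move=> psi i; rewrite linear0 scaler0.
move=> [s [F [Us Ps wF F0 ->]]] [t [G [Ut Pt wG G0 ->]]].
exists (undup (s ++ t)), (fun chi => k *: F chi + G chi); split.
- exact: undup_uniq.
- by move=> chi; rewrite mem_undup mem_cat => /orP[/Ps|/Pt].
- move=> chi i; rewrite linearP wF wG scalerDr !scalerA.
  by rewrite [k * _]mulrC.
- move=> chi; rewrite mem_undup mem_cat negb_or => /andP[/F0 -> /G0 ->].
  by rewrite scaler0 addr0.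
- have widen (r : seq (I -> K)) E : uniq r -> {subset r <= s ++ t} ->
      (forall chi, chi \notin r -> E chi = 0) ->
      \sum_(chi <- r) E chi = \sum_(chi <- undup (s ++ t)) E chi :> V.
    move=> Ur sub E0; rewrite [RHS](bigID (mem r)) /= [X in _ + X]big1 ?addr0.
      rewrite -[RHS]big_filter; apply: perm_big; apply: uniq_perm => //.
        by rewrite filter_uniq ?undup_uniq.
      move=> chi; rewrite mem_filter mem_undup /=.
      by case: (boolP (chi \in r)) => // /sub ->.
    by move=> chi /E0.
  rewrite big_split -scaler_sumr /= -(widen s F) ?(widen t G) // => chi.
    by rewrite mem_cat orbC => ->.
  by rewrite mem_cat => ->.
Qed.

(** If [psi <> chi] differ at [i], then [f i - chi i] kills the [chi]-term and
    rescales the [psi]-term by a nonzero factor; so the terms can be isolated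
    one after another without leaving [W]. *)
Lemma weight_sum_mem W (s : seq (I -> K)) (F : (I -> K) -> V) :
  lsubspace W -> stable W -> uniq s ->
  (forall chi, chi \in s -> weight_vec chi (F chi)) ->
  W (\sum_(chi <- s) F chi) -> forall chi, chi \in s -> W (F chi).
Proof.
move=> Wsub Wst; elim: s F => [//|chi0 s IH] F /= /andP[s'chi0 Us] wF WF.
have tailW psi : psi \in s -> W (F psi).
  move=> s_psi.
  have /existsNP[i psi_i] : ~ forall i, psi i = chi0 i.
    move=> eq_psi; move: s'chi0; have <- : psi = chi0 by apply/funext.
    by rewrite s_psi.
  have := IH (fun chi => (chi i - chi0 i) *: F chi) Us _ _ psi s_psi.
  have nz : psi i - chi0 i != 0 by rewrite subr_eq0; apply/eqP.
  move=> WIH; rewrite -[F psi]scale1r -(mulVf nz) -scalerA.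
  apply: lsubspaceZ => //; apply: WIH.
    move=> chi s_chi j; rewrite linearZ /= wF ?inE ?s_chi ?orbT //.
    by rewrite !scalerA mulrC.
  have -> : \sum_(chi <- s) (chi i - chi0 i) *: F chi =
      f i (\sum_(chi <- chi0 :: s) F chi)
      - chi0 i *: \sum_(chi <- chi0 :: s) F chi.
    rewrite !big_cons linearD /= wF ?inE ?eqxx // scalerDr.
    rewrite opprD addrACA subrr add0r linear_sum scaler_sumr -sumrB.
    apply: eq_big_seq => chi s_chi; rewrite wF ?inE ?s_chi ?orbT //.
    by rewrite scalerBl.
  by apply: lsubspaceB => //; [apply: Wst | apply: lsubspaceZ].
move=> chi; rewrite inE => /predU1P[->|/tailW//].
have -> : F chi0 = \sum_(psi <- chi0 :: s) F psi - \sum_(psi <- s) F psi.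
  by rewrite big_cons addrK.
by apply: lsubspaceB => //; apply: lsubspace_sum.
Qed.

(** The difference of two expansions of [v], one with weights in [P] and one
    with weights outside, has pairwise distinct weights and sum [0]. *)
Lemma weight_span_disjoint P v :
  weight_span P v -> weight_span (~` P) v -> v = 0.
Proof.
move=> /weight_span_sum[s [F [Us Ps wF F0 v_s]]].
move=> /weight_span_sum[t [G [Ut Pt wG G0 v_t]]].
have st chi : chi \in s -> chi \notin t.
  by move=> /Ps Pchi; apply/negP => /Pt.
pose E chi := if chi \in s then F chi else - G chi.
rewrite v_s big_seq big1 // => chi s_chi.
have /= := @weight_sum_mem [set 0] (s ++ t) E _ _ _ _ _ chi.
rewrite mem_cat s_chi /E s_chi; apply => //.
- by split=> // k x y -> ->; rewrite scaler0 addr0.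
- by move=> i x ->; rewrite linear0.
- rewrite cat_uniq Us Ut andbT /=; apply/hasPn => psi t_psi.
  by apply/negP => /st; rewrite t_psi.
- move=> psi _; case: ifP => _ // i.
  by rewrite scalerN -wG raddfN.
- rewrite big_cat /= -[RHS](subrr v) {1}v_s v_t -sumrN.
  congr (_ + _); apply: eq_big_seq => psi; first by move=> ->.
  by move=> t_psi; rewrite ifN //; apply: contraL t_psi => /st.
Qed.

End LinearAlgebra.

(** An eigenspace of [h] is stable under the commuting operator [f], so it
    contains the [f]-components of its elements. *)
Lemma diagonalizable_eigen_split (K : fieldType) (V : lmodType K)
    (f h : {linear V -> V}) (mu : K) (v : V) :
  diagonalizable_op f -> (forall x, f (h x) = h (f x)) -> h v = mu *: v ->
  lspan [set x | h x = mu *: x /\ exists l, f x = l *: x] v.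
Proof.
move=> f_diag fh hv.
have : weight_span (fun _ : unit => f) setT v.
  have : lspan [set x | exists l, f x = l *: x] v by rewrite f_diag.
  apply: lspan_sub; first exact: lspan_lsubspace.
  by move=> x [l fx]; apply: mem_lspan; exists (fun=> l).
move=> /weight_span_sum[s [F [Us _ wF _ v_s]]].
have sub : lsubspace [set x | h x = mu *: x].
  split=> [|k x y /= hx hy]; first by rewrite /= linear0 scaler0.
  by rewrite linearP hx hy scalerDr !scalerA mulrC.
rewrite v_s; apply: lsubspace_sum; first exact: lspan_lsubspace.
move=> chi s_chi; apply: mem_lspan; split; last by exists (chi tt); apply: wF.
apply: (weight_sum_mem (f := fun _ : unit => f) (W := [set x | h x = mu *: x])) s_chi => //.
  by move=> i x /= hx; rewrite -fh hx linearZ.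
by rewrite -v_s.
Qed.

(** * The exponential on the unit circle *)

Section Exponential.
Context (R : realType).
Implicit Types (s t : R) (n : int).

Lemma e2piD s t : e2pi (s + t) = e2pi s * e2pi t.
Proof.
rewrite /e2pi mulrDr cosD sinD; apply/eqP; rewrite eq_complex /= eqxx /=.
by rewrite addrC.
Qed.

Lemma realC_add s t : (s + t)%:C = s%:C + t%:C.
Proof. exact: (rmorphD (real_complex R)). Qed.

Lemma realC_sub_int t n : (t - n%:~R)%:C = t%:C - n%:~R.
Proof. by rewrite (rmorphB (real_complex R)) rmorph_int. Qed.

Lemma e2pi0 : e2pi (0 : R) = 1.
Proof. by rewrite /e2pi mulr0 cos0 sin0. Qed.

Lemma e2pi_int n : e2pi (n%:~R : R) = 1.
Proof.
have e2pi1 : e2pi (1 : R) = 1.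
  by rewrite /e2pi mulr1 mulr_natl cos2pi sin2pi.
have e2pi_nat (m : nat) : e2pi (m%:R : R) = 1.
  elim: m => [|m IH]; first exact: e2pi0.
  by rewrite -addn1 natrD e2piD IH e2pi1 mul1r.
case: (intP n) => [|m|m]; first exact: e2pi0.
  exact: e2pi_nat.
have <- : e2pi (- m.+1%:Z%:~R + m.+1%:R : R) = 1 by rewrite addNr e2pi0.
by rewrite e2piD e2pi_nat mulr1 mulrNz.
Qed.

(** For the fractional part [u] of [t], [cos (2 pi u) = 1] forces
    [sin (pi u) = 0], whereas the sine is positive on [0 < pi u < pi]. *)
Lemma e2pi_eq1 t : e2pi t = 1 -> exists n, t = n%:~R.
Proof.
move=> et; exists (Num.floor t); have /andP[le_t lt_t] := floor_itv t.
set u := t - (Num.floor t)%:~R.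
have : e2pi u = 1 by rewrite e2piD et -mulrNz e2pi_int mulr1.
move=> /(congr1 (@complex.Re R)) /= cos_u.
have sin_u : sin (pi * u) = 0.
  apply/eqP; rewrite -sqrf_eq0 sin2cos2.
  have := cos_mulr2n (pi * u); rewrite -mulrnAl -mulr_natl cos_u.
  move=> /eqP; rewrite eq_sym subr_eq -mulr2n -subr_eq0 -mulrnBl mulrn_eq0 /=.
  by rewrite subr_eq0 => /eqP ->; rewrite subrr.
apply/eqP; rewrite eq_le le_t andbT -subr_le0 leNgt -/u; apply/negP => u_gt0.
suff : 0 < sin (pi * u) by rewrite sin_u ltxx.
apply: sin_gt0_pi; rewrite mulr_gt0 ?pi_gt0 //= gtr_pMr ?pi_gt0 //.
by rewrite ltrBlDl -intrD1.
Qed.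

Lemma e2pi_onto (l : R[i]) : `|l| = 1 -> exists t, l = e2pi t.
Proof.
case: l => x y; rewrite normc_def /= => /(congr1 (@complex.Re R)) /= nrm.
have xy1 : x ^+ 2 + y ^+ 2 = 1.
  rewrite -[LHS]sqr_sqrtr ?nrm ?expr1n //.
  by rewrite addr_ge0 ?sqr_ge0.
have x_bnd : -1 <= x <= 1.
  rewrite -ler_norml -(@ler_pXn2r _ 2) ?nnegrE // expr1n real_normK ?num_real //.
  by rewrite -xy1 lerDl sqr_ge0.
have sinx : sin (acos x) = `|y|.
  by rewrite sin_acos // -xy1 [x ^+ 2 + _]addrC addrK sqrtr_sqr.
have cosx : cos (acos x) = x by rewrite acosK // in_itv.
have pi2 : 2 * pi != 0 :> R by rewrite mulf_neq0 ?pnatr_eq0 // gt_eqF ?pi_gt0.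
have [y_ge0|y_lt0] := leP 0 y.
  exists (acos x / (2 * pi)); rewrite /e2pi mulrC divfK // cosx sinx.
  by rewrite ger0_norm.
exists (- acos x / (2 * pi)); rewrite /e2pi mulrC divfK // cosN sinN cosx sinx.
by rewrite ltr0_norm ?opprK.
Qed.

End Exponential.

(** * Maximal spectra of quotients *)

Section Cosets.
Context (R : realType) (T : vertexSuperalgebra R) (C : set T).
Hypothesis C_sub : lsubspace C.

Lemma cls_eqP (a b : T) : cls C a = cls C b <-> C (a - b).
Proof.
split=> [ab|Cab].
  have : cls C a a by rewrite /cls /= subrr; case: C_sub.
  by rewrite ab.
apply/seteqP; rewrite /cls; split=> c /= Cc.
  have -> : c - b = (c - a) + (a - b) by rewrite addrA subrK.
  exact: lsubspaceD.
have -> : c - a = (c - b) - (a - b) by rewrite opprB addrA subrK.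
exact: lsubspaceB.
Qed.

Lemma cls_eq0 (a : T) : C a -> cls C a = cls C 0.
Proof. by move=> Ca; apply/cls_eqP; rewrite subr0. Qed.

End Cosets.

(** What makes [f] induce an algebra morphism [S / C -> S' / C']. An ideal in
    the sense of [quot_ideal] is closed under multiplication of representatives,
    so it absorbs all that [C] generates; this lets ideals be transported even
    where [C] and [C'] are treated as mere subspaces. *)
Record coset_hom (R : realType) (T T' : vertexSuperalgebra R)
    (S C : set T) (S' C' : set T') (f : T -> T') : Prop := CosetHom {
  coset_hom_linear : linear f;
  coset_hom_sub : forall a, S a -> S' (f a);
  coset_hom_ker : forall a, C a -> C' (f a);
  coset_hom_mul : forall a b, S a -> S b ->
    C' (f (vs_prod (-1) a b) - vs_prod (-1) (f a) (f b))
}.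

Section Comap.
Context (R : realType) (T T' : vertexSuperalgebra R).
Context (S C : set T) (S' C' : set T') (f : T -> T').
Hypotheses (S_sub : lsubspace S) (C_sub : lsubspace C) (C'_sub : lsubspace C').
Hypothesis S_mul : forall a b, S a -> S b -> S (vs_prod (-1) a b).
Hypothesis f_hom : coset_hom S C S' C' f.

Let fB a b : f (a - b) = f a - f b.
Proof.
have := coset_hom_linear f_hom (-1) b a.
by rewrite !scaleN1r ![- _ + _]addrC.
Qed.

Let f0 : f 0 = 0.
Proof. by rewrite -(subrr (0 : T)) fB subrr. Qed.

Lemma comap_clsP m a : S a -> comap f S C C' m (cls C a) <-> m (cls C' (f a)).
Proof.
move=> Sa; split=> [[b [Sb /(cls_eqP C_sub) Cab]]|mfa]; last by exists a.
have -> // : cls C' (f a) = cls C' (f b).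
by apply/(cls_eqP C'_sub); rewrite -fB; apply: (coset_hom_ker f_hom).
Qed.

Lemma comap_comp (T'' : vertexSuperalgebra R) (S0 C0 : set T'') (h : T'' -> T)
    m : (forall a, S0 a -> S (h a)) ->
  comap h S0 C0 C (comap f S C C' m) = comap (f \o h) S0 C0 C' m.
Proof.
move=> hS; apply/seteqP; split=> X [a [Sa -> ma]]; exists a; split=> //.
  by move: ma => /comap_clsP; apply; apply: hS.
by apply/comap_clsP => //; apply: hS.
Qed.

Hypothesis f_surj : forall b, S' b -> exists2 a, S a & f a = b.

Lemma comap_ideal m : quot_ideal S' C' m -> quot_ideal S C (comap f S C C' m).
Proof.
move=> [m_sub m0 m_lin m_mul]; have fS := coset_hom_sub f_hom.
split.
- by move=> X [a [Sa -> _]]; exists a.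
- by apply/comap_clsP; [case: S_sub | rewrite f0].
- move=> k a b Sa Sb /(comap_clsP _ Sa) ma /(comap_clsP _ Sb) mb.
  apply/comap_clsP; first exact: S_sub.2.
  by rewrite (coset_hom_linear f_hom); apply: m_lin => //; apply: fS.
- move=> a b Sa Sb /(comap_clsP _ Sb) mb.
  have [mab mba] := m_mul _ _ (fS _ Sa) (fS _ Sb) mb.
  have prod_eq x y : S x -> S y ->
      cls C' (f (vs_prod (-1) x y)) = cls C' (vs_prod (-1) (f x) (f y)).
    by move=> Sx Sy; apply/(cls_eqP C'_sub); apply: (coset_hom_mul f_hom).
  by split; apply/comap_clsP; rewrite ?prod_eq //; apply: S_mul.
Qed.

(** The inverse image of a maximal ideal under a surjective morphism is maximal:
    an ideal [J] containing it is the inverse image of its own direct image. *)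
Lemma comap_Specm m : Specm S' C' m -> Specm S C (comap f S C C' m).
Proof.
move=> [m_ideal m_proper m_max]; have fS := coset_hom_sub f_hom.
have [m_sub m0 _ _] := m_ideal.
split; first exact: comap_ideal.
  move=> all_m; apply: m_proper; apply/seteqP; split=> // X [b /f_surj[a Sa <-] <-].
  by apply/comap_clsP => //; rewrite all_m; exists a.
move=> J J_ideal mJ; have [J_sub J0 J_lin J_mul] := J_ideal.
(* [J] contains the kernel of the induced morphism, hence is a union of its
   fibres. *)
have J_fiber a b : S a -> S b -> C' (f a - f b) -> J (cls C b) -> J (cls C a).
  move=> Sa Sb Cab Jb; rewrite -[a](subrK b) -[a - b]scale1r.
  have Sab : S (a - b) by apply: lsubspaceB.
  apply: J_lin => //; apply: mJ; apply/comap_clsP => //.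
  by rewrite fB cls_eq0.
pose J' := [set X | exists2 a, S a & X = cls C' (f a) /\ J (cls C a)].
have J'P a : S a -> J' (cls C' (f a)) -> J (cls C a).
  move=> Sa [b Sb [/(cls_eqP C'_sub) ab Jb]].
  exact: (J_fiber a b).
have J'_ideal : quot_ideal S' C' J'.
  split.
  - by move=> X [a Sa [-> _]]; exists (f a) => //; apply: fS.
  - by exists 0; [case: S_sub | rewrite f0].
  - move=> k x y /f_surj[a Sa <-] /f_surj[b Sb <-] /(J'P _ Sa) Ja /(J'P _ Sb) Jb.
    exists (k *: a + b); first exact: S_sub.2.
    by rewrite (coset_hom_linear f_hom); split=> //; apply: J_lin.
  - move=> x y /f_surj[a Sa <-] /f_surj[b Sb <-] /(J'P _ Sb) Jb.
    have [Jab Jba] := J_mul _ _ Sa Sb Jb.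
    split; [exists (vs_prod (-1) a b) | exists (vs_prod (-1) b a)];
      try exact: S_mul; split=> //; apply/esym/(cls_eqP C'_sub);
      exact: (coset_hom_mul f_hom).
have mJ' : m `<=` J'.
  move=> X mX; have [_ /f_surj[a Sa <-] aX] := m_sub _ mX.
  rewrite -aX in mX *; exists a => //; split=> //.
  by apply: mJ; apply/comap_clsP.
have [J'm|J'T] := m_max J' J'_ideal mJ'; [left|right]; apply/seteqP; split=> //.
- move=> X JX; have [a Sa aX] := J_sub _ JX; rewrite -aX in JX *.
  by apply/comap_clsP => //; rewrite -J'm; exists a.
- by move=> _ [a Sa <-]; apply: J'P => //; rewrite J'T; exists (f a) => //; apply: fS.
Qed.

End Comap.

(** * Zariski dimension of a subset *)

Section Dimension.
Context (W : Type) (A B : set (set W)).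
Hypothesis AB : A `<=` B.

Definition zclosure (Z : set (set W)) : set (set W) :=
  [set m | B m /\ [set w | forall m', Z m' -> m' w] `<=` m].

Lemma zclosure_trace Z : zclosed A Z -> zclosure Z `&` A = Z.
Proof.
move=> [F ZE]; apply/seteqP; split=> m.
  move=> [[_ mI] Am]; rewrite ZE; split=> // w Fw.
  by apply: mI => m'; rewrite ZE => -[_]; apply.
move=> Zm; have Am : A m by move: Zm; rewrite ZE => -[].
by split=> //; split=> [|w]; [apply: AB | apply].
Qed.

Lemma zclosure_irreducible Z : zirreducible A Z -> zirreducible B (zclosure Z).
Proof.
move=> [Zcl [m0 Zm0] Zirr]; have ZE := zclosure_trace Zcl.
split.
- by exists [set w | forall m', Z m' -> m' w].
- by exists m0; move: Zm0; rewrite -{1}ZE => -[].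
have trace_closed Y : zclosed B Y -> zclosed A (Y `&` A).
  move=> [F ->]; exists F; apply/seteqP; split=> m /=.
    by move=> [[_ Fm] Am].
  by move=> [Am Fm]; split=> //; split=> //; apply: AB.
have closure_sub Y : zclosed B Y -> Z `<=` Y -> zclosure Z `<=` Y.
  move=> [F YE] ZY m [Bm mI]; rewrite YE; split=> // w Fw; apply: mI => m' /ZY.
  by rewrite YE => -[_]; apply.
move=> Z1 Z2 Z1cl Z2cl ZU.
have ZU' : Z = (Z1 `&` A) `|` (Z2 `&` A) by rewrite -setIUl -ZU.
have [ZZ|ZZ] := Zirr _ _ (trace_closed _ Z1cl) (trace_closed _ Z2cl) ZU'.
  left; apply/seteqP; split; last by rewrite ZU; apply: subsetUl.
  by apply: closure_sub => // m; rewrite ZZ => -[].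
right; apply/seteqP; split; last by rewrite ZU; apply: subsetUr.
by apply: closure_sub => // m; rewrite ZZ => -[].
Qed.

(** Closing up in [B] turns a chain of irreducible closed subsets of [A] into
    one of [B], still strict because the closures trace the old sets on [A]. *)
Lemma dim_le_subset n : dim_le n B -> dim_le n A.
Proof.
move=> dimB [Z [Zirr Zlt]]; apply: dimB; exists (zclosure \o Z); split=> i i_n /=.
  exact/zclosure_irreducible/Zirr.
have [ZiS ZSi] := Zlt i i_n; split.
  move=> m [Bm mI]; split=> // w wI; apply: mI => m' /ZiS; exact: wI.
move=> clS; apply: ZSi.
have [Zcl _ _] := Zirr i (leqW i_n).
have [ZScl _ _] := Zirr i.+1 i_n.
rewrite -(zclosure_trace Zcl) -(zclosure_trace ZScl); exact: setSI.
Qed.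

End Dimension.

(** * The splitting of a vertex superalgebra by a twist *)

Section Products.
Context (R : realType) (T : vertexSuperalgebra R).
Implicit Types (a b : T) (n : int).

HB.instance Definition _ n a :=
  GRing.isLinear.Build R[i] T T *:%R (vs_prod n a) (vs_prod_linearr n a).

Definition rprod n b a := vs_prod n a b.

HB.instance Definition _ n b :=
  GRing.isLinear.Build R[i] T T *:%R (rprod n b) (vs_prod_linearl n b).

Lemma vs_prodZl n k a b : vs_prod n (k *: a) b = k *: vs_prod n a b.
Proof. exact: (linearZ_LR (rprod n b)). Qed.

Lemma vs_prodZr n k a b : vs_prod n a (k *: b) = k *: vs_prod n a b.
Proof. exact: (linearZ_LR (vs_prod n a)). Qed.

Lemma vs_prod0l n b : vs_prod n 0 b = 0.
Proof. exact: (linear0 (rprod n b)). Qed.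

Lemma der_prodN2 a b :
  vs_prod (-2) a b = vs_der (vs_prod (-1) a b) - vs_prod (-1) a (vs_der b).
Proof. by rewrite vs_translation scaleN1r opprK. Qed.

Lemma vs_derE a : vs_der a = vs_prod (-2) a (vs_vac T).
Proof. by rewrite der_prodN2 vs_vacr vs_der_vac linear0 subr0. Qed.

End Products.

(** The part of being an automorphism, a Hamiltonian operator and simultaneously
    diagonalizable that is inherited by quotients. *)
Record twist_datum (R : realType) (T : vertexSuperalgebra R)
    (g H : {linear T -> T}) : Prop := TwistDatum {
  twist_prod : forall n a b, g (vs_prod n a b) = vs_prod n (g a) (g b);
  twist_vac : g (vs_vac T) = vs_vac T;
  twist_ham : forall (n : int) (a b : T),
    H (vs_prod n a b) - vs_prod n a (H b)
      = vs_prod n (H a) b - (n + 1)%:~R *: vs_prod n a b;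
  twist_span : lspan [set a | exists x, has_eps g H a x] = setT
}.

Lemma eps_exists (R : realType) (t : R) :
  exists (x : R) (n : int), -1 < x <= 0 /\ x = t + n%:~R.
Proof.
exists (t - (Num.ceil t)%:~R), (- Num.ceil t); rewrite mulrNz; split=> //.
have /andP[lt_t le_t] := ceil_itv t.
by rewrite subr_le0 le_t andbT ltrBrDl; move: lt_t; rewrite intrB.
Qed.

Lemma eps_int (R : realType) (x : R) (n : int) :
  -1 < x <= 0 -> x = n%:~R -> x = 0.
Proof.
move=> /andP[x_gt x_le] xn; move: x_gt x_le; rewrite xn.
rewrite -[X in - X]/(1%:~R) -mulrNz ltr_int lerz0 => n_gt n_le.
suff -> : n = 0 by [].
by apply/eqP; rewrite eq_le n_le /= -(addNr 1) lezD1.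
Qed.

Section Twist.
Context (R : realType) (T : vertexSuperalgebra R) (g H : {linear T -> T}).
Hypothesis gH_twist : twist_datum g H.
Implicit Types (a b : T) (x y z : R).

Notation eps := (has_eps g H).
Notation T0 := (tw_sub g H).
Notation T1 := (tw_other g H).
Notation proj := (tw_proj g H).

Let T0_sub : lsubspace T0 := lspan_lsubspace _.
Let T1_sub : lsubspace T1 := lspan_lsubspace _.

Lemma tw_C_lsubspace : lsubspace (tw_C g H).
Proof.
have [s0 sl] := lspan_lsubspace
  [set c | exists a b x y, [/\ eps a x, eps b y &
                  c = vs_prod (-2 + chi x y) a b]].
split; first by split=> //; case: T0_sub.
by move=> k a b [? ?] [? ?]; split; [apply: sl | apply: T0_sub.2].
Qed.

Lemma eigen_eps (gamma Delta : R) a :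
  g a = e2pi gamma *: a -> H a = Delta%:C *: a ->
  exists2 x, eps a x & exists n : int, x = gamma - Delta + n%:~R.
Proof.
move=> ga Ha; have [x [n [x_bnd xE]]] := eps_exists (gamma - Delta).
exists x; last by exists n.
exists gamma, Delta; split=> //; exists n.
by rewrite xE addrAC subrK.
Qed.

Lemma eps_ind (P : set T) :
  lsubspace P -> (forall a x, eps a x -> P a) -> forall a, P a.
Proof.
move=> P_sub Peps a; suff : setT `<=` P by apply.
rewrite -(twist_span gH_twist); apply: lspan_sub => // b [x]; exact: Peps.
Qed.

Lemma eps_ind2 (P : T -> T -> Prop) :
  (forall b, lsubspace (P^~ b)) -> (forall a, lsubspace (P a)) ->
  (forall a b x y, eps a x -> eps b y -> P a b) -> forall a b, P a b.
Proof.
move=> Pl Pr Peps a b; apply: (eps_ind (Pl b)).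
move=> {}a x ax.
by apply: (eps_ind (Pr a)) => {}b y; apply: Peps ax.
Qed.

Lemma eps_prod n a b x y z (k : int) : eps a x -> eps b y ->
  -1 < z <= 0 -> z = x + y + k%:~R -> eps (vs_prod n a b) z.
Proof.
move=> [c [D [ga Ha _ [m xE]]]] [c' [D' [gb Hb _ [m' yE]]]] z_bnd zE.
exists (c + c'), (D + D' - (n + 1)%:~R); split=> //.
- by rewrite (twist_prod gH_twist) ga gb vs_prodZl vs_prodZr scalerA e2piD.
- have /eqP := twist_ham gH_twist n a b.
  rewrite subr_eq => /eqP ->; rewrite Ha Hb vs_prodZl vs_prodZr.
  rewrite -scalerBl -scalerDl; congr (_ *: _).
  by rewrite realC_sub_int realC_add addrAC.
- exists (m + m' + k - (n + 1)).
  have -> : z + (D + D' - (n + 1)%:~R) =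
      (x + D) + (y + D') + k%:~R - (n + 1)%:~R.
    by rewrite zE; ring.
  by rewrite xE yE !(intrD, intrB); ring.
Qed.

Lemma eps_vac : eps (vs_vac T) 0.
Proof.
have Hvac : H (vs_vac T) = 0.
  have := twist_ham gH_twist (-1) (vs_vac T) (vs_vac T).
  by rewrite !vs_vacl vs_vacr /= subrr addNr scale0r subr0 => <-.
exists 0, 0; split; last by exists 0.
- by rewrite e2pi0 scale1r; apply: twist_vac gH_twist.
- by rewrite Hvac scale0r.
- by rewrite lexx andbT ltrN10.
Qed.

(** The sum [x + y] lies in [-2 < x + y <= 0], so it is an integer only if it is
    [-1], or is [0] with both summands [0]; otherwise its residue modulo the
    integers gives the product a nonzero [epsilon]. *)
Lemma eps_cases a b x y : eps a x -> eps b y ->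
  [\/ x = 0 /\ y = 0, x + y = -1 |
      (x != 0 \/ y != 0) /\ forall n, T1 (vs_prod n a b)].
Proof.
move=> ax bY; have [_ [_ [_ _ /andP[x_gt x_le] _]]] := ax.
have [_ [_ [_ _ /andP[y_gt y_le] _]]] := bY.
have [xy_le|xy_gt] := leP (x + y) (-1).
  have [xyE|xy_ne] := eqVneq (x + y) (-1); first by constructor 2.
  have z_ne : x + y + 1 != 0 by rewrite addr_eq0.
  constructor 3; split.
    have [x0|] := eqVneq x 0; last by left.
    by move: xy_le; rewrite x0 add0r leNgt y_gt.
  move=> n; apply: mem_lspan; exists (x + y + 1) => //.
  apply: (eps_prod n (k := 1) ax bY) => //.
  by apply/andP; split; lra.
have [xyE|xy_ne] := eqVneq (x + y) 0.
  by constructor 1; split; lra.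
constructor 3; split.
  by have [x0|] := eqVneq x 0; [right; rewrite x0 add0r in xy_ne | left].
move=> n; apply: mem_lspan; exists (x + y) => //.
apply: (eps_prod n (k := 0) ax bY); last by rewrite addr0.
by apply/andP; split; lra.
Qed.

Let ops (i : bool) : {linear T -> T} := if i then g else H.

Let invariant : set (bool -> R[i]) := [set chi | exists (t : R) (n : int),
  chi true = e2pi t /\ chi false = (t + n%:~R)%:C].

(** The number [epsilon_a] is a function of the two eigenvalues of [a <> 0], so
    [T0] and [T1] are spanned by joint eigenvectors for complementary sets of
    pairs of eigenvalues. *)
Lemma tw_sub_other_disjoint a : T0 a -> T1 a -> a = 0.
Proof.
move=> a0 a1; apply: (@weight_span_disjoint _ _ _ ops invariant).
  move: a a0 {a1}; apply: lspan_sub => [|a [c [D [ga Ha _ [n /=]]]]].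
    exact: lspan_lsubspace.
  rewrite add0r => DE; apply: mem_lspan.
  exists (fun i => if i then e2pi c else D%:C); last by case.
  by exists c, n; rewrite DE.
move: a a1 {a0}; apply: lspan_sub => [|a [x x_ne [c [D [ga Ha x_bnd [n xE]]]]]].
  exact: lspan_lsubspace.
apply: mem_lspan; exists (fun i => if i then e2pi c else D%:C); last by case.
move=> [t [m [ct Dm]]]; move: x_ne; apply/negP/negPn/eqP.
have [k ctk] : exists k : int, c - t = k%:~R.
  apply: e2pi_eq1; rewrite e2piD ct -e2piD subrr; exact: e2pi0.
have DE : D = t + m%:~R by move: Dm => [].
apply: (eps_int (n := k + n - m)) => //.
have -> : x = (x + D) - D by rewrite addrK.
by rewrite xE DE !(intrD, intrB) -ctk; ring.
Qed.

Lemma tw_projE a a0 : T0 a0 -> T1 (a - a0) -> proj a = a0.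
Proof.
move=> Ta0 Taa0; apply: xget_unique => // b [Tb Tab].
apply/eqP; rewrite -subr_eq0; apply/eqP/tw_sub_other_disjoint.
  exact: (lsubspaceB T0_sub).
have -> : b - a0 = (a - a0) - (a - b).
  by rewrite opprB [RHS]addrC addrA subrK.
exact: (lsubspaceB T1_sub).
Qed.

Lemma tw_projP a : T0 (proj a) /\ T1 (a - proj a).
Proof.
suff [a0 [Ta0 Taa0]] : exists a0, T0 a0 /\ T1 (a - a0) by rewrite (tw_projE Ta0).
move: a; apply: eps_ind => [|a x ax].
  split; first by exists 0; rewrite subr0; split; [case: T0_sub | case: T1_sub].
  move=> k a b [a0 [Ta0 Taa0]] [b0 [Tb0 Tbb0]]; exists (k *: a0 + b0).
  split; first exact: T0_sub.2.
  by rewrite opprD addrACA -scalerBr; apply: T1_sub.2.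
have [x0|x_ne] := eqVneq x 0.
  exists a; rewrite subrr; split; last by case: T1_sub.
  by apply: mem_lspan; rewrite -x0.
exists 0; rewrite subr0; split; first by case: T0_sub.
by apply: mem_lspan; exists x.
Qed.

Lemma tw_proj_linear : linear proj.
Proof.
move=> k a b; have [[Ta Ta'] [Tb Tb']] := (tw_projP a, tw_projP b).
apply: tw_projE; first exact: T0_sub.2.
by rewrite opprD addrACA -scalerBr; apply: T1_sub.2.
Qed.

Lemma tw_proj_id a : T0 a -> proj a = a.
Proof. by move=> Ta; apply: tw_projE => //; rewrite subrr; case: T1_sub. Qed.

Lemma tw_proj_other a : T1 a -> proj a = 0.
Proof. by move=> Ta; apply: tw_projE; rewrite ?subr0 //; case: T0_sub. Qed.

Lemma tw_sub_eps a : eps a 0 -> T0 a.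
Proof. by move=> ax; apply: mem_lspan. Qed.

Lemma tw_proj_eps_neq0 a x : eps a x -> x != 0 -> proj a = 0.
Proof.
by move=> ax x_ne; apply: tw_proj_other; apply: mem_lspan; exists x.
Qed.

Lemma chi_wrap x y : x + y = -1 -> chi x y = 1.
Proof. by rewrite /chi => ->; rewrite lexx. Qed.

Lemma chi00 : chi (0 : R) 0 = 0.
Proof. by rewrite /chi add0r leNgt ltrN10. Qed.

Lemma tw_C_eps a b x y : eps a x -> eps b y ->
  T0 (vs_prod (-2 + chi x y) a b) -> tw_C g H (vs_prod (-2 + chi x y) a b).
Proof. by move=> ax bY Tab; split=> //; apply: mem_lspan; exists a, b, x, y. Qed.

Let eps0_bnd : -1 < (0 : R) <= 0.
Proof. by rewrite lexx andbT ltrN10. Qed.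

Lemma eps_prod_wrap n a b x y :
  eps a x -> eps b y -> x + y = -1 -> eps (vs_prod n a b) 0.
Proof.
move=> ax bY xy; apply: (eps_prod n (k := 1) ax bY) => //.
by rewrite xy addNr.
Qed.

Lemma eps_der a x : eps a x -> eps (vs_der a) x.
Proof.
move=> ax; rewrite vs_derE; apply: (eps_prod _ (k := 0) ax eps_vac).
  by case: ax => [? [? []]].
by rewrite !addr0.
Qed.

Lemma tw_C_der a : eps a 0 -> tw_C g H (vs_der a).
Proof.
move=> ax; have := tw_C_eps ax eps_vac; rewrite chi00 addr0 -vs_derE; apply.
by apply: tw_sub_eps; apply: eps_der.
Qed.

(** For [epsilon_a + epsilon_b = -1] only the products [a_(-1) b] are among the
    generators of [tw_C]; the product [a_(-2) b] is reached by the Leibniz rule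
    for the translation operator. *)
Lemma tw_proj_C2 c : C2 T c -> tw_C g H (proj c).
Proof.
have C_sub := tw_C_lsubspace.
move: c; apply: lspan_sub => [|c [a [b ->]]].
  exact: lsubspace_preim tw_proj_linear C_sub.
move: a b; apply: eps_ind2 => [b|a|a b x y ax bY].
- have lin : linear (proj \o rprod (-2) b).
    by move=> k a a'; rewrite /= linearP tw_proj_linear.
  exact: lsubspace_preim lin C_sub.
- have lin : linear (proj \o vs_prod (-2) a).
    by move=> k b b'; rewrite /= linearP tw_proj_linear.
  exact: lsubspace_preim lin C_sub.
have [[x0 y0]|xy|[_ Tab]] := eps_cases ax bY.
- rewrite x0 y0 in ax bY; have := tw_C_eps ax bY.
  rewrite chi00 addr0 => Cab.
  have Tab : T0 (vs_prod (-2) a b).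
    by apply: tw_sub_eps; apply: (eps_prod _ (k := 0) ax bY); rewrite ?addr0.
  by rewrite tw_proj_id //; apply: Cab.
- rewrite tw_proj_id; last by apply: tw_sub_eps; apply: (eps_prod_wrap _ ax bY).
  rewrite der_prodN2; apply: lsubspaceB => //.
    by apply: tw_C_der; apply: (eps_prod_wrap _ ax bY).
  have := tw_C_eps ax (eps_der bY); rewrite chi_wrap //; apply.
  by apply: tw_sub_eps; apply: (eps_prod_wrap _ ax (eps_der bY)).
- by rewrite tw_proj_other //; case: C_sub.
Qed.

(** A product of two components outside [T0] can return to [T0] only if
    [epsilon_a + epsilon_b = -1], and then it lies in [tw_C]. *)
Lemma tw_proj_mul a b :
  tw_C g H (proj (vs_prod (-1) a b) - vs_prod (-1) (proj a) (proj b)).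
Proof.
have C_sub := tw_C_lsubspace.
move: a b; apply: eps_ind2 => [b|a|a b x y ax bY].
- pose F a := proj (rprod (-1) b a) - rprod (-1) (proj b) (proj a).
  have lin : linear F.
    move=> k a a'; rewrite /F linearP !tw_proj_linear linearP.
    by rewrite scalerBr opprD addrACA.
  exact: lsubspace_preim lin C_sub.
- pose F b := proj (vs_prod (-1) a b) - vs_prod (-1) (proj a) (proj b).
  have lin : linear F.
    move=> k b b'; rewrite /F linearP !tw_proj_linear linearP.
    by rewrite scalerBr opprD addrACA.
  exact: lsubspace_preim lin C_sub.
have [[x0 y0]|xy|[xy_ne Tab]] := eps_cases ax bY.
- rewrite x0 y0 in ax bY; have Ta := tw_sub_eps ax; have Tb := tw_sub_eps bY.
  have Tab : T0 (vs_prod (-1) a b).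
    by apply: tw_sub_eps; apply: (eps_prod _ (k := 0) ax bY); rewrite ?addr0.
  by rewrite !tw_proj_id // subrr; case: C_sub.
- have x_ne : x != 0.
    apply/eqP => x0; move: bY => [_ [_ [_ _ /andP[+ _] _]]].
    by rewrite -xy x0 add0r ltxx.
  have Tab := tw_sub_eps (eps_prod_wrap (-1) ax bY xy).
  rewrite (tw_proj_eps_neq0 ax x_ne) vs_prod0l subr0 tw_proj_id //.
  by have := tw_C_eps ax bY; rewrite chi_wrap //; apply.
- rewrite tw_proj_other // sub0r; have -> : vs_prod (-1) (proj a) (proj b) = 0.
    case: xy_ne => [x_ne|y_ne]; first by rewrite (tw_proj_eps_neq0 ax) ?vs_prod0l.
    by rewrite (tw_proj_eps_neq0 bY) ?linear0.
  by rewrite oppr0; case: C_sub.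
Qed.

Lemma tw_sub_mul a b : T0 a -> T0 b -> T0 (vs_prod (-1) a b).
Proof.
move=> Ta Tb; move: a Ta; apply: lspan_sub => [|a ax].
  exact: (lsubspace_preim (vs_prod_linearl (-1) b) T0_sub).
move: b Tb; apply: lspan_sub => [|b bY].
  exact: (lsubspace_preim (vs_prod_linearr (-1) a) T0_sub).
by apply: tw_sub_eps; apply: (eps_prod _ (k := 0) ax bY); rewrite ?addr0.
Qed.

Lemma tw_proj_coset_hom : coset_hom setT (C2 T) T0 (tw_C g H) proj.
Proof.
split=> [|a _|a|a b _ _].
- exact: tw_proj_linear.
- exact: (tw_projP a).1.
- exact: tw_proj_C2.
- exact: tw_proj_mul.
Qed.

Lemma tw_var_in_sub : tw_var_in g H `<=` assoc_var T.
Proof.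
move=> _ [m m_max <-]; apply: (comap_Specm _ _ _ _ tw_proj_coset_hom) m_max => //.
- exact: lspan_lsubspace.
- exact: tw_C_lsubspace.
- by move=> b Tb; exists b => //; apply: tw_proj_id.
Qed.

End Twist.

(** * Twists by a Hamiltonian operator and an automorphism *)

Section Hamiltonian.
Context (R : realType) (V : vertexSuperalgebra R) (H g : {linear V -> V}).
Hypotheses (H_ham : hamiltonian H)
  (H_real : forall l : R[i], eigenval H l -> exists x : R, l = x%:C)
  (g_aut : vs_automorphism g) (g_diag : diagonalizable_op g)
  (gH : forall v : V, g (H v) = H (g v))
  (g_mod1 : forall l : R[i], eigenval g l -> `|l| = 1).

Lemma eigen_joint_span (Delta : R) (v : V) : H v = Delta%:C *: v ->
  lspan [set a | H a = Delta%:C *: a /\ exists t : R, g a = e2pi t *: a] v.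
Proof.
move=> /(diagonalizable_eigen_split g_diag gH); move: v.
apply: lspan_sub => [|a [Ha [l ga]]]; first exact: lspan_lsubspace.
apply: mem_lspan; split=> //.
have [-> | a_ne] := eqVneq a 0; first by exists 0; rewrite linear0 scaler0.
have /g_mod1/e2pi_onto[t lt] : eigenval g l by exists a.
by exists t; rewrite ga lt.
Qed.

Lemma ham_span :
  lspan [set v | exists Delta : R, H v = Delta%:C *: v] = setT.
Proof.
apply/seteqP; split=> // v _; have : setT v by [].
rewrite -H_ham.1; move: v; apply: lspan_sub => [|v [l Hv]].
  exact: lspan_lsubspace.
have [-> | v_ne] := eqVneq v 0; first by case: (lspan_lsubspace
  [set v | exists Delta : R, H v = Delta%:C *: v]).
have [D lD] : exists D : R, l = D%:C by apply: H_real; exists v.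
by apply: mem_lspan; exists D; rewrite -lD.
Qed.

Lemma ham_twist_datum : twist_datum g H.
Proof.
split.
- by case: g_aut => -[].
- by case: g_aut => -[].
- by case: H_ham.
apply/seteqP; split=> // v _; have : setT v by [].
rewrite -ham_span; move: v; apply: lspan_sub => [|v [D /eigen_joint_span]].
  exact: lspan_lsubspace.
move: v; apply: lspan_sub => [|a [Ha [t ga]]]; first exact: lspan_lsubspace.
by have [x ax _] := eigen_eps ga Ha; apply: mem_lspan; exists x.
Qed.

Lemma expH_spec (t : R) (a : V) : exists s : seq (R * V),
  [/\ forall u, u \in s -> H u.2 = (u.1)%:C *: u.2,
      a = \sum_(u <- s) u.2 &
      expH H t a = \sum_(u <- s) e2pi (t * u.1) *: u.2].
Proof.
suff [s [s_eig sE]] : exists s : seq (R * V),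
    (forall u, u \in s -> H u.2 = (u.1)%:C *: u.2) /\ a = \sum_(u <- s) u.2.
  rewrite /expH; case: xgetP => [b _ //|/(_ (\sum_(u <- s) e2pi (t * u.1) *: u.2))].
  by case; exists s.
have : setT a by [].
rewrite -ham_span; move: a; apply: lspan_sub => [|a [D Ha]]; last first.
  by exists [:: (D, a)]; rewrite big_seq1; split=> // u; rewrite inE => /eqP ->.
split; first by exists [::]; rewrite big_nil.
move=> k a b [s [s_eig ->]] [s' [s'_eig ->]].
exists ([seq (u.1, k *: u.2) | u <- s] ++ s').
rewrite big_cat big_map -scaler_sumr; split=> // u; rewrite mem_cat => /orP[|/s'_eig//].
move=> /mapP[w /s_eig Hw ->] /=.
by rewrite linearZ_LR Hw !scalerA mulrC.
Qed.

(** [g o theta_H^{-1}] multiplies a homogeneous element by the exponential of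
    [epsilon_a], hence is the identity modulo [tw_other]. *)
Lemma twist_op_sub (a : V) : tw_other g H (twist_op g H a - a).
Proof.
rewrite /twist_op; have [s [s_eig aE ->]] := expH_spec (-1) a.
rewrite [X in _ - X]aE linear_sum -sumrB.
have T1_sub : lsubspace (tw_other g H) by apply: lspan_lsubspace.
apply: (lsubspace_sum T1_sub) => -[D v] /s_eig /= /eigen_joint_span; move: v.
apply: (lspan_sub (B := [set v | tw_other g H (g (e2pi (-1 * D) *: v) - v)])).
  apply: (lsubspace_preim (f := fun v => g (e2pi (-1 * D) *: v) - v)) => //.
  move=> k x y; rewrite scalerDr linearD scalerA mulrC -scalerA linearZ_LR.
  by rewrite scalerBr opprD addrACA.
move=> v [Hv [t gv]] /=; rewrite linearZ_LR gv scalerA -e2piD.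
rewrite -[X in _ - X]scale1r -scalerBl.
have [x vx [n xE]] := eigen_eps gv Hv.
have [x0|x_ne] := eqVneq x 0.
  have -> : -1 * D + t = (- n)%:~R.
    by rewrite mulrNz -[LHS](addrK n%:~R) mulN1r [- D + t]addrC -xE x0 sub0r.
  by rewrite e2pi_int subrr scale0r; case: T1_sub.
by apply: (lsubspaceZ _ T1_sub); apply: mem_lspan; exists x.
Qed.

(** The element [s a - a], for [s] the operator [g o theta_H^{-1}], projects to
    [0], and so lies in every ideal pulled back along the projection. *)
Lemma tw_var_in_fixed : tw_var_in g H `<=` fixed_locus g H.
Proof.
have tw := ham_twist_datum; move=> M M_tw; split.
  exact: (tw_var_in_sub tw).
case: M_tw => m [[_ m0 _ _] _ _] <- a.
exists (twist_op g H a - a); split=> //.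
by rewrite tw_proj_other //; apply: twist_op_sub.
Qed.

End Hamiltonian.

(** * Passage to a quotient *)

Section Quotient.
Context (R : realType) (V U : vertexSuperalgebra R).
Context (H g : {linear V -> V}) (HU gU : {linear U -> U}) (q : {linear V -> U}).
Hypotheses (V_twist : twist_datum g H)
  (q_mor : vs_morphism q) (q_surj : forall u, exists v, q v = u)
  (gU_ind : forall v : V, gU (q v) = q (g v))
  (HU_ind : forall v : V, HU (q v) = q (H v)).

Let q_prod n a b : q (vs_prod n a b) = vs_prod n (q a) (q b).
Proof. by case: q_mor. Qed.

Lemma quot_eps a x : has_eps g H a x -> has_eps gU HU (q a) x.
Proof.
move=> [c [D [ga Ha x_bnd xE]]]; exists c, D; split=> //.
  by rewrite gU_ind ga linearZ_LR.
by rewrite HU_ind Ha linearZ_LR.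
Qed.

Lemma quot_lspan (A : set V) (B : set U) a :
  (forall a, A a -> B (q a)) -> lspan A a -> lspan B (q a).
Proof.
move=> AB; move: a; apply: lspan_sub => [|a /AB]; last exact: mem_lspan.
apply: lsubspace_preim; [exact: linearP | exact: lspan_lsubspace].
Qed.

Lemma quot_twist_datum : twist_datum gU HU.
Proof.
split.
- move=> n u v; have [a <-] := q_surj u; have [b <-] := q_surj v.
  by rewrite -q_prod !gU_ind (twist_prod V_twist) q_prod.
- have [q_vac _ _ _] := q_mor.
  by rewrite -q_vac gU_ind (twist_vac V_twist).
- move=> n u v; have [a <-] := q_surj u; have [b <-] := q_surj v.
  rewrite -q_prod !HU_ind -!q_prod -linearB (twist_ham V_twist).
  by rewrite linearB linearZ_LR.
- apply/seteqP; split=> // u _; have [a <-] := q_surj u.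
  apply: (quot_lspan (A := [set a | exists x, has_eps g H a x])).
    by move=> b [x bx]; exists x; apply: quot_eps.
  by rewrite (twist_span V_twist).
Qed.

Lemma quot_tw_sub a : tw_sub g H a -> tw_sub gU HU (q a).
Proof. by apply: quot_lspan => b bx; apply: quot_eps. Qed.

Lemma quot_tw_other a : tw_other g H a -> tw_other gU HU (q a).
Proof. by apply: quot_lspan => b [x x_ne bx]; exists x => //; apply: quot_eps. Qed.

Lemma quot_tw_proj a : tw_proj gU HU (q a) = q (tw_proj g H a).
Proof.
have [Ta Ta'] := tw_projP V_twist a.
apply: tw_projE; first exact: quot_tw_sub.
by rewrite -linearB; apply: quot_tw_other.
Qed.

Lemma quot_coset_hom : coset_hom (tw_sub g H) (tw_C g H)
  (tw_sub gU HU) (tw_C gU HU) q.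
Proof.
split=> [|a|a [Ca Ta]|a b _ _].
- by move=> k a b; rewrite linearP.
- exact: quot_tw_sub.
- split; last exact: quot_tw_sub.
  apply: quot_lspan Ca => c [a' [b [x [y [ax bY ->]]]]].
  exists (q a'), (q b), x, y; rewrite q_prod.
  by split=> //; apply: quot_eps.
- by rewrite q_prod subrr; case: (tw_C_lsubspace gU HU).
Qed.

Lemma quot_tw_sub_surj u : tw_sub gU HU u -> exists2 a, tw_sub g H a & q a = u.
Proof.
move=> Tu; have [a au] := q_surj u; exists (tw_proj g H a).
  exact: (tw_projP V_twist a).1.
by rewrite -quot_tw_proj au tw_proj_id.
Qed.

(** The two ways from [V / C_2(V)] to [R_{g,H}(U)], over [U / C_2(U)] and over
    [R_{g,H}(V)], agree, and a point of [X_{g,H}(U)] is pulled back to [X_V]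
    along both. *)
Lemma pull_tw_var_sub :
  pull_var q (tw_var_in gU HU) `<=` pull_var q (assoc_var U) `&` tw_var_in g H.
Proof.
have U_twist := quot_twist_datum; move=> _ [P P_tw <-]; split.
  by exists P => //; apply: (tw_var_in_sub U_twist).
case: P_tw => m m_max <-.
exists (comap q (tw_sub g H) (tw_C g H) (tw_C gU HU) m).
  apply: (comap_Specm _ _ _ _ quot_coset_hom) m_max.
  - exact: lspan_lsubspace.
  - exact: tw_C_lsubspace.
  - exact: tw_C_lsubspace.
  - exact: (tw_sub_mul V_twist).
  - exact: quot_tw_sub_surj.
rewrite (comap_comp _ _ quot_coset_hom); first last.
- by move=> a _; apply: (tw_projP V_twist a).1.
- exact: tw_C_lsubspace.
- exact: tw_C_lsubspace.
rewrite (comap_comp _ _ (tw_proj_coset_hom U_twist)) //; first last.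
- exact: tw_C_lsubspace.
- exact: lspan_lsubspace.
suff -> : q \o tw_proj g H = tw_proj gU HU \o q by [].
by apply/funext => a /=; rewrite quot_tw_proj.
Qed.

End Quotient.

(** * Lisse quotients *)

Theorem proposition5p2 (R : realType) (V : vertexSuperalgebra R)
    (H g : {linear V -> V})
    (H_ham : hamiltonian H)
    (H_real : forall l : R[i], eigenval H l -> exists x : R, l = x%:C)
    (g_aut : vs_automorphism g)
    (g_diag : diagonalizable_op g)
    (gH : forall v : V, g (H v) = H (g v))
    (g_mod1 : forall l : R[i], eigenval g l -> `|l| = 1)
    (d : Order.disp_t) (I : orderType d) (e : I -> V)
    (e_homog : homogeneous_generators e g H)
    (e_free : freely_generated e)
    (Gamma : set R) (Gamma_sub : additive_subgroup Gamma)
    (Gamma_discr : discrete_subset Gamma)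
    (V_pregr : pregraded e Gamma)
    (J : set V) (J_ideal : vs_ideal J)
    (J_g : forall v : V, J v -> J (g v))
    (J_H : forall v : V, J v -> J (H v))
    (U : vertexSuperalgebra R) (q : {linear V -> U})
    (U_quot : vs_quotient J q)
    (gU HU : {linear U -> U})
    (gU_ind : forall v : V, gU (q v) = q (g v))
    (HU_ind : forall v : V, HU (q v) = q (H v)) :
  pull_var q (tw_var_in gU HU)
    `<=` pull_var q (assoc_var U) `&` tw_var_in g H
  /\
  (lisse_along (assoc_var V) (pull_var q (assoc_var U)) (moved_locus g H) ->
   dim0 (pull_var q (tw_var_in gU HU))).
Proof.
have V_twist := ham_twist_datum H_ham H_real g_aut g_diag gH g_mod1.
have [q_mor q_surj _] := U_quot.
have incl := pull_tw_var_sub V_twist q_mor q_surj gU_ind HU_ind.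
split=> // lisse; apply: dim_le_subset lisse => M /incl[M_U M_tw].
have M_fix : fixed_locus g H M by apply: tw_var_in_fixed M_tw.
by split=> //; split; [case: M_fix | case].
Qed.
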